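(* Let $p$ be an odd prime, $q$ a power of $p$, $l\ge 0$ an integer, $n=p^l+1$, and $k$ an integer with $0\le k\le p-1$ and $k\neq 0,2$. Then $D_{n,k}(1,x)$ is a permutation polynomial of $\mathbb{F}_q$ if and only if $l=0$.
   Context: For an integer $n\ge1$, $D_{n,k}(1,x)=\sum_{i=0}^{\lfloor n/2\rfloor}\frac{n-ki}{n-i}\binom{n-i}{i}(-x)^i\in\mathbb{F}_q[x]$ (the coefficients are integers, reduced mod $p$). A permutation polynomial of $\mathbb{F}_q$ is a polynomial inducing a bijection of $\mathbb{F}_q$. *)

(* Defs.v *)
From mathcomp Require Import all_boot all_order all_algebra.
From mathcomp Require Import zify ring.

Set Implicit Arguments.
Unset Strict Implicit.
Unset Printing Implicit Defensive.

Import Order.TTheory GRing.Theory Num.Theory.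
Local Open Scope ring_scope.

(* The integer (n - k i) / (n - i) * binomial (n - i, i). Integer division is
   used here, but it is exact for 0 < n and i <= n / 2: see rdickson_coefE. *)
Definition rdickson_coef (n : nat) (k : int) (i : nat) : int :=
  (((n%:Z - k * i%:Z) * ('C(n - i, i))%:Z) %/ (n - i)%N%:Z)%Z.

(* The reversed Dickson polynomial D_{n,k}(1,x) of the (k+1)-th kind; the cast
   %:~R reduces the integer coefficients modulo the characteristic of R. *)
Definition rdickson (R : nzRingType) (n : nat) (k : int) : {poly R} :=
  \sum_(0 <= i < n./2.+1) (rdickson_coef n k i)%:~R *: (- 'X) ^+ i.

Definition permutation_poly (F : finFieldType) (f : {poly F}) : Prop :=
  bijective (fun x : F => f.[x]).

Lemma rdickson_coef_dvd (n : nat) (k : int) (i : nat) :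
  (0 < n)%N -> (i <= n./2)%N ->
  ((n - i)%N%:Z %| (n%:Z - k * i%:Z) * ('C(n - i, i))%:Z)%Z.
Proof.
move=> n_gt0 le_in; have [lt_in le_i_n] : (i < n)%N /\ (i <= n)%N by lia.
case: i => [|i] in le_in lt_in le_i_n *; first by rewrite mulr0 !subr0 subn0 dvdz_mulr.
have -> : n%:Z - k * i.+1%:Z = (n - i.+1)%N%:Z - (k - 1) * i.+1%:Z.
  by rewrite -subzn //; ring.
rewrite mulrBl -mulrA -!PoszM -mul_bin_diag.
by apply: rpredB; [|apply: dvdz_mull]; apply: dvdn_mulr.
Qed.

Lemma rdickson_coefE (n : nat) (k : int) (i : nat) :
  (0 < n)%N -> (i <= n./2)%N ->
  (rdickson_coef n k i)%:~R =
    (n%:R - k%:~R * i%:R) / (n%:R - i%:R) * ('C(n - i, i))%:R :> rat.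
Proof.
move=> n_gt0 le_in; have lt_in : (i < n)%N by lia.
have d_neq0 : (n%:R - i%:R : rat) != 0 by rewrite -natrB ?(ltnW lt_in) // pnatr_eq0; lia.
apply: (mulIf d_neq0); rewrite mulrAC divfK // -natrB ?(ltnW lt_in) //.
have := congr1 (fun z : int => z%:~R : rat)
  (divzK (rdickson_coef_dvd k n_gt0 le_in)).
by rewrite -/(rdickson_coef n k i) !intrM rmorphB /= intrM.
Qed.

(* Main.v *)
(** Let [E_n(x) = sum_i C(n - i, i) (-x)^i].  Splitting the coefficients gives
    [D_(n+2,k)(1,x) = E_(n+2)(x) + (k - 1) x E_n(x)], and if [y + z = 1] then
    [(y - z) E_n(yz) = y^(n+1) - z^(n+1)].  For [n + 1 = p^l = 2m + 1] the
    Frobenius map turns the latter into closed forms in [v = (y - z)^2 = 1 - 4yz],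
    so that [4 D_(p^l+1,k)(1,x) = 2 + v^m (k + (2 - k) v)] with [v = 1 - 4x].
    This is affine in [x] if [m = 0]; if [m > 0] it takes the same value at
    [v = 0] and at [v = k / (k - 2)], which is nonzero. *)
Require Import Defs.
From mathcomp Require Import all_boot all_order all_algebra.
From mathcomp Require Import finfield zify ring.

Import Order.TTheory GRing.Theory Num.Theory.
Local Open Scope ring_scope.

(** The sum runs to [n] rather than [n./2]: the binomials beyond [n./2] vanish, and the longer range
    simplifies index shifts. *)
Definition dickson2 {R : nzRingType} (n : nat) (x : R) : R :=
  \sum_(i < n.+1) 'C(n - i, i)%:R * (- x) ^+ i.

Section Dickson2.
Variable R : comNzRingType.
Implicit Types x y z : R.

Lemma dickson2_0 x : dickson2 0 x = 1.
Proof. by rewrite /dickson2 big_ord1 bin0 mul1r. Qed.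

Lemma dickson2_1 x : dickson2 1 x = 1.
Proof. by rewrite /dickson2 !big_ord_recl big_ord0 /= bin0 mul1r mul0r !addr0. Qed.

Lemma dickson2_rec n x :
  dickson2 n.+2 x = dickson2 n.+1 x - x * dickson2 n x.
Proof.
rewrite /dickson2 big_ord_recl [X in _ = X - _]big_ord_recl /= !bin0 -addrA.
congr (_ + _); rewrite big_ord_recr /= /bump /= !add1n subnn bin0n mul0r addr0.
rewrite mulr_sumr -sumrB; apply: eq_bigr => i _; rewrite /bump /= !add1n.
have -> : (n.+2 - i.+1 = (n - i).+1)%N by have := ltn_ord i; lia.
by rewrite subSS binS natrD exprS; ring.
Qed.

Lemma rmorph_dickson2 (S : comNzRingType) (f : {rmorphism R -> S}) n x :
  f (dickson2 n x) = dickson2 n (f x).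
Proof.
rewrite rmorph_sum /=; apply: eq_bigr => i _.
by rewrite rmorphM rmorph_nat rmorphXn rmorphN.
Qed.

(** As [y] and [z] are the roots of T^2 - T + yz, both sides satisfy the recurrence of
    [dickson2_rec]. *)
Lemma dickson2_mul n y z : y + z = 1 ->
  (y - z) * dickson2 n (y * z) = y ^+ n.+1 - z ^+ n.+1.
Proof.
move=> yz1; have -> : z = 1 - y by rewrite -yz1; ring.
suff: (y - (1 - y)) * dickson2 n (y * (1 - y)) = y ^+ n.+1 - (1 - y) ^+ n.+1 /\
   (y - (1 - y)) * dickson2 n.+1 (y * (1 - y)) = y ^+ n.+2 - (1 - y) ^+ n.+2.
  by case.
elim: n => [|n [IH0 IH1]]; first by rewrite dickson2_0 dickson2_1; split; ring.
split=> //; rewrite dickson2_rec mulrBr IH1 mulrCA IH0 !exprS; ring.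
Qed.

Lemma dickson2_pchar n y z : [pchar R].-nat n.+1 -> y + z = 1 ->
  (y - z) * dickson2 n (y * z) = (y - z) ^+ n.+1.
Proof.
move=> charn yz1; rewrite dickson2_mul //.
by rewrite -[y in LHS](subrK z) exprDn_pchar // addrK.
Qed.

(** Twice y^(n+2) - z^(n+2) is a combination of the sum and the difference of the powers y^(n+1),
    z^(n+1); Frobenius evaluates both. *)
Lemma dickson2_pcharS n y z : [pchar R].-nat n.+1 -> y + z = 1 ->
  2 * ((y - z) * dickson2 n.+1 (y * z)) = (y - z) + (y - z) ^+ n.+1.
Proof.
move=> charn yz1.
have Es : y ^+ n.+1 + z ^+ n.+1 = 1 by rewrite -exprDn_pchar // yz1 expr1n.
rewrite -(dickson2_pchar _ _ _ charn yz1) !dickson2_mul // ![_ ^+ n.+2]exprS.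
transitivity ((y - z) * (y ^+ n.+1 + z ^+ n.+1) +
  (y + z) * (y ^+ n.+1 - z ^+ n.+1)); first by ring.
by rewrite Es yz1 mulr1 mul1r.
Qed.

Lemma horner_rdickson n k x :
  (rdickson R n.+2 k).[x] = dickson2 n.+2 x + (k - 1)%:~R * x * dickson2 n x.
Proof.
have coef0 : rdickson_coef n.+2 k 0 = 1.
  by rewrite /rdickson_coef mulr0 subr0 bin0 mulr1 subn0 divzz.
have coefS i : (i <= n)%N -> rdickson_coef n.+2 k i.+1 =
    'C(n.+2 - i.+1, i.+1)%:Z - (k - 1) * 'C(n - i, i)%:Z.
  move=> le_in; rewrite /rdickson_coef.
  have -> : (n.+2 - i.+1 = (n - i).+1)%N by lia.
  have bd := mul_bin_diag (n - i).+1 i; rewrite /= in bd.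
  (* Multiplying back by the divisor avoids reasoning about the quotient; absorption,
     [mul_bin_diag], then matches the numerators. *)
  rewrite -[RHS](@mulzK _ (n - i).+1%:Z) //; congr (_ %/ _)%Z.
  have -> : n.+2%:Z = (n - i).+1%:Z + i.+1%:Z by lia.
  have {}bd : (n - i).+1%:Z * 'C(n - i, i)%:Z = i.+1%:Z * 'C((n - i).+1, i.+1)%:Z.
    by rewrite -!PoszM bd.
  transitivity ((n - i).+1%:Z * 'C((n - i).+1, i.+1)%:Z
     - (k - 1) * (i.+1%:Z * 'C((n - i).+1, i.+1)%:Z)); first by ring.
  by rewrite -bd; ring.
(* These vanishing coefficients let the sum be extended to the range used by [dickson2]. *)
have zero i : (n.+2./2 < i <= n.+1)%N -> rdickson_coef n.+2 k i = 0.
  case: i => [|i] // hi; rewrite coefS; last by lia.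
  by rewrite !bin_small ?mulr0 ?subr0 //; lia.
have -> : (rdickson R n.+2 k).[x] =
    \sum_(i < n.+2) (rdickson_coef n.+2 k i)%:~R * (- x) ^+ i.
  rewrite /rdickson horner_sum big_mkord.
  rewrite [LHS](eq_bigr (fun i : 'I__ => (rdickson_coef n.+2 k i)%:~R * (- x) ^+ i)).
    rewrite (big_ord_widen n.+2 (fun i => (rdickson_coef n.+2 k i)%:~R * (- x) ^+ i));
      last by lia.
    rewrite big_mkcond /=; apply: eq_bigr => i _; case: ltnP => // hi.
    by rewrite zero ?mul0r //; have := ltn_ord i; lia.
  by move=> i _; rewrite hornerZ horner_exp hornerN hornerX.
rewrite /dickson2 big_ord_recl coef0 [in RHS]big_ord_recl bin0 -addrA.
congr (_ + _); rewrite [in RHS]big_ord_recr /= /bump /= !add1n subnn bin0n mul0r addr0.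
rewrite mulr_sumr -big_split /=; apply: eq_bigr => i _; rewrite /bump /= !add1n.
rewrite coefS; last by have := ltn_ord i; lia.
by rewrite rmorphB rmorphM /= -!pmulrn exprS; ring.
Qed.

End Dickson2.

Section FieldOddChar.
Variable F : fieldType.
Hypothesis two_neq0 : 2 != 0 :> F.

(* Substituting [(1 - 'X^2) / 4 = y z] with [y, z = (1 +- 'X) / 2] supplies the
   square root ['X] of [1 - 4 y z] without extending the field. *)
Lemma dickson2_closed m (x : F) : [pchar F].-nat m.*2.+1 ->
  dickson2 m.*2 x = (1 - 4 * x) ^+ m /\
  2 * dickson2 m.*2.+1 x = 1 + (1 - 4 * x) ^+ m.
Proof.
move=> charm; pose h : {poly F} := (2^-1)%:P.
have h2 : 2 * h = 1 by rewrite /h -polyC_natr -polyCM divff.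
pose y : {poly F} := h * (1 + 'X); pose z : {poly F} := h * (1 - 'X).
have yz1 : y + z = 1 by rewrite -h2 /y /z; ring.
have ymz : y - z = 'X.
  by rewrite -[RHS]mul1r -h2 /y /z; ring.
have vE : (1 - 4 * 'X : {poly F}) \Po (y * z) = 'X ^+ 2.
  rewrite rmorphB rmorphM rmorph1 /= comp_polyX -polyC_natr comp_polyC polyC_natr.
  transitivity ((y + z) ^+ 2 - 4 * (y * z)); first by rewrite yz1 expr1n.
  by rewrite -ymz; ring.
(* If y z were constant, the left side of [vE] would be constant too, unlike 'X^2. *)
have sz : (1 < size (y * z)%R)%N.
  apply: contraTT isT; rewrite -leqNgt => /size1_polyC yzC.
  move: vE; rewrite {1}yzC comp_polyCr => /(congr1 (fun P : {poly F} => size P)).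
  by rewrite size_polyC size_polyXn; case: (_ != 0).
have charP : [pchar {poly F}].-nat m.*2.+1.
  by apply: sub_in_pnat charm => q _; rewrite pchar_poly.
(* Composition with a nonconstant polynomial is injective, so identities proved at y z descend to
   the indeterminate. *)
have inj (P Q : {poly F}) : 'X * (P \Po (y * z)) = 'X * (Q \Po (y * z)) -> P = Q.
  move=> /(mulfI (negbT (polyX_eq0 F))) /eqP.
  by rewrite -subr_eq0 -rmorphB /= comp_poly_eq0 // subr_eq0 => /eqP.
have vmE : ((1 - 4 * 'X) ^+ m : {poly F}) \Po (y * z) = 'X ^+ m.*2.
  by rewrite rmorphXn /= vE -exprM mul2n.
have E0 : dickson2 m.*2 'X = (1 - 4 * 'X) ^+ m :> {poly F}.
  apply: inj; rewrite vmE rmorph_dickson2 /= comp_polyX.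
  by rewrite -{1}ymz dickson2_pchar // ymz -exprS.
have E1 : 2 * dickson2 m.*2.+1 'X = 1 + (1 - 4 * 'X) ^+ m :> {poly F}.
  apply: inj; rewrite comp_polyD vmE rmorph1 rmorphM rmorph_nat.
  rewrite rmorph_dickson2 /= comp_polyX mulrCA -{1}ymz dickson2_pcharS // ymz.
  by rewrite mulrDr mulr1 -exprS.
have hv : (1 - 4 * 'X : {poly F}).[x] = 1 - 4 * x.
  by rewrite hornerD hornerN hornerM hornerX -polyC_natr !hornerC.
have ev n : (dickson2 n 'X).[x] = dickson2 n x.
  by rewrite -[LHS]/(horner_eval x _) rmorph_dickson2 /= /horner_eval hornerX.
split; first by rewrite -ev E0 horner_exp hv.
by rewrite -ev -hv -horner_exp -[X in X + _](hornerC 1 x) -hornerD -E1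
  hornerM -polyC_natr hornerC.
Qed.

(** One step of the recurrence leaves E_(2m+1) + (k - 2) x E_(2m), where 4x = 1 - v. *)
Lemma rdickson_closed m (k : int) (x : F) : [pchar F].-nat m.*2.+1 ->
  4 * (rdickson F m.*2.+2 k).[x] =
  2 + (1 - 4 * x) ^+ m * (k%:~R + (2 - k%:~R) * (1 - 4 * x)).
Proof.
move=> /(dickson2_closed _ x) [E0 E1].
rewrite horner_rdickson dickson2_rec E0 rmorphB rmorph1 /=.
transitivity (2 * (2 * dickson2 m.*2.+1 x) +
  4 * (k%:~R - 2) * x * (1 - 4 * x) ^+ m); first by ring.
by rewrite E1; ring.
Qed.

End FieldOddChar.

Theorem theorem2p13 (F : finFieldType) (p e l n : nat) (k : int)
    (p_prime : prime p) (p_odd : odd p)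
    (e_gt0 : (0 < e)%N) (card_F : #|F| = (p ^ e)%N)
    (n_def : n = (p ^ l + 1)%N)
    (k_range : 0 <= k <= p%:Z - 1) (k_neq0 : k <> 0) (k_neq2 : k <> 2) :
  permutation_poly (rdickson F n k) <-> l = 0%N.
Proof.
have charF : p \in [pchar F] by exact: card_finPcharP card_F p_prime.
have p_gt2 : (2 < p)%N by rewrite odd_prime_gt2.
have two_neq0 : 2 != 0 :> F by rewrite -(dvdn_pcharf charF) gtnNdvd.
have four_neq0 : 4 != 0 :> F.
  by rewrite (_ : 4 = 2 * 2); [rewrite mulf_neq0|ring].
pose m := (p ^ l)./2.
have qE : (p ^ l = m.*2.+1)%N.
  by rewrite -[LHS]odd_double_half oddX p_odd orbT.
have charq : [pchar F].-nat m.*2.+1.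
  by rewrite -qE pnatX (eq_pnat _ (pcharf_eq charF)) pnat_id.
have DE x := rdickson_closed F two_neq0 m k x charq.
have k_neq0F : k%:~R != 0 :> F.
  case: k k_range k_neq0 {k_neq2 DE} => // a a_lt a_neq0.
  by rewrite -pmulrn -(dvdn_pcharf charF) gtnNdvd //; lia.
have k_neq2F : k%:~R - 2 != 0 :> F.
  case: k k_range k_neq0 k_neq2 {DE k_neq0F} => // [[|[|a]]] // a_lt _ a_neq2.
    (* The case k = 1, where k - 2 = -1 is negative; afterwards k - 2 is a natural number strictly
       between 0 and p. *)
    by rewrite -oppr_eq0 opprB (_ : 2 - 1 = 1) ?oner_eq0 //; ring.
  rewrite -pmulrn -addn2 natrD addrK -(dvdn_pcharf charF) gtnNdvd //; lia.
rewrite n_def addn1 qE; split=> [/bij_inj inj|l0].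
  apply/eqP; rewrite -leqn0 leqNgt; apply/negP => l_gt0.
  have m_gt0 : (0 < m)%N.
    have : (p ^ 1 <= p ^ l)%N by rewrite leq_pexp2l // prime_gt0.
    by lia.
  (* These points make v^m and k + (2 - k) v vanish, respectively; the former requires m > 0, since
     v^0 = 1. *)
  pose x0 : F := 1 / 4; pose x1 : F := (1 - k%:~R / (k%:~R - 2)) / 4.
  have v0 : 1 - 4 * x0 = 0 by rewrite /x0; field.
  have v1 : 1 - 4 * x1 = k%:~R / (k%:~R - 2) by rewrite /x1; field; rewrite k_neq2F.
  have /inj x01 : (rdickson F m.*2.+2 k).[x0] = (rdickson F m.*2.+2 k).[x1].
    apply: (mulfI four_neq0); rewrite !DE v0 v1 expr0n gtn_eqF //=.
    have -> : k%:~R + (2 - k%:~R) * (k%:~R / (k%:~R - 2)) = 0 :> F by field.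
    by rewrite mul0r mulr0.
  by move: v1; rewrite -x01 v0 => /esym/eqP; rewrite mulf_eq0 invr_eq0
    (negPf k_neq0F) (negPf k_neq2F).
have m0 : m = 0%N by rewrite /m l0 expn0.
(* Over a finite field injectivity suffices, and for m = 0 the slope in v is 2 - k, which is
   nonzero. *)
apply: injF_bij => x x' /(congr1 ( *%R 4)); rewrite !DE m0 !expr0 !mul1r.
have k2_neq0F : 2 - k%:~R != 0 :> F by rewrite -oppr_eq0 opprB.
by move=> /addrI /addrI /(mulfI k2_neq0F) /addrI /oppr_inj /(mulfI four_neq0).
Qed.
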